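(* Let $S$ be a semigroup with exponent $n$. Then the enhanced power graph $\mathcal{P}_e(S)$ is complete if and only if $S$ is a monogenic semigroup.
   Context: For $z \in S$, $\langle z \rangle = \{z^m : m \geq 1\}$ is the subsemigroup generated by $z$. A semigroup $S$ is monogenic if $S = \langle a \rangle$ for some $a \in S$. $S$ is of bounded exponent if there is a positive integer $n$ such that $x^n$ is idempotent for every $x \in S$ (the idempotent may depend on $x$); in that case the exponent of $S$ is the least such $n$. ''$S$ has exponent $n$'' means $S$ is of bounded exponent with exponent $n$. The enhanced power graph $\mathcal{P}_e(S)$ of a semigroup $S$ is the simple undirected graph with vertex set $S$ in which two distinct vertices $x, y$ are adjacent if and only if $x, y \in \langle z \rangle$ for some $z \in S$. A graph is complete if any two distinct vertices are adjacent. *)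

(* Defs.v *)
From mathcomp Require Import all_boot.
From mathcomp Require Import classical_sets.

Set Implicit Arguments.
Unset Strict Implicit.
Unset Printing Implicit Defensive.

Local Open Scope classical_set_scope.

(* [natexp] needs a unit, so semigroups have no library power. This is its
   analogue: x * (x * ... * x) with m factors. The value at m = 0 is junk (x);
   every use below has m >= 1. *)
Definition sexp (S : semigroupType) (x : S) (m : nat) : S :=
  iterop m *%g x x.

Definition monogenic_sub (S : semigroupType) (z : S) : set S :=
  [set x | exists2 m : nat, 0 < m & x = sexp z m].

Definition monogenic (S : semigroupType) : Prop :=
  exists a : S, [set: S] = monogenic_sub a.

Definition is_idempotent (S : semigroupType) (e : S) : Prop :=
  (e * e)%g = e.

Definition exponent_bounds (S : semigroupType) : set nat :=
  [set n | 0 < n /\ forall x : S, is_idempotent (sexp x n)].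

Definition has_exponent (S : semigroupType) (n : nat) : Prop :=
  exponent_bounds S n /\ forall m, exponent_bounds S m -> n <= m.

Record simple_graph (V : Type) := SimpleGraph {
  adj : V -> V -> Prop;
  adj_sym : forall x y, adj x y -> adj y x;
  adj_irrefl : forall x, ~ adj x x
}.

Definition complete_graph (V : Type) (G : simple_graph V) : Prop :=
  forall x y : V, x <> y -> adj G x y.

Definition epg_adj (S : semigroupType) (x y : S) : Prop :=
  x <> y /\ exists z : S, monogenic_sub z x /\ monogenic_sub z y.

Lemma epg_adj_sym (S : semigroupType) (x y : S) : epg_adj x y -> epg_adj y x.
Proof.
by move=> [xy [z [zx zy]]]; split; [exact: nesym | exists z].
Qed.

Lemma epg_adj_irrefl (S : semigroupType) (x : S) : ~ epg_adj x x.
Proof. by case. Qed.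

Definition enhanced_power_graph (S : semigroupType) : simple_graph S :=
  SimpleGraph (@epg_adj_sym S) (@epg_adj_irrefl S).

(* Main.v *)
(* If [x ^ n] is idempotent, then [x ^ (2n) = x ^ n], so [<x>] has at most [2n]
   elements. Choose [x] with [<x>] of maximal size: every [y] lies together
   with [x] in some [<z>], which contains [<x>] and so equals it. *)
Require Import Defs.
From mathcomp Require Import all_boot.
From mathcomp Require Import boolp classical_sets.
Local Open Scope classical_set_scope.

Section SemigroupPowers.
Context {S : semigroupType}.
Implicit Types x y z : S.

Lemma sexpS x m : sexp x m.+2 = (x * sexp x m.+1)%g.
Proof. by []. Qed.

(** Positivity matters: [sexp x 0] is [x], not a unit. *)
Lemma sexpD x m k : 0 < m -> 0 < k -> sexp x (m + k) = (sexp x m * sexp x k)%g.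
Proof.
case: k => // k; case: m => // m _ _.
elim: m => [//|m IHm].
by rewrite sexpS -mulgA -IHm !addSn sexpS.
Qed.

Lemma sexpM x m k : 0 < m -> 0 < k -> sexp (sexp x m) k = sexp x (m * k).
Proof.
case: k => // k m_gt0 _; elim: k => [|k IHk]; first by rewrite muln1.
by rewrite sexpS IHk -sexpD ?muln_gt0 ?m_gt0 // -mulnS.
Qed.

Lemma monogenic_sub_refl x : monogenic_sub x x.
Proof. by exists 1. Qed.

Lemma monogenic_sub_trans x y z :
  monogenic_sub z y -> monogenic_sub y x -> monogenic_sub z x.
Proof.
move=> [m m_gt0 ->] [k k_gt0 ->]; exists (m * k); first by rewrite muln_gt0 m_gt0.
exact: sexpM.
Qed.

(** Duplicates are removed so that, when [x ^ n] is idempotent, the size is the cardinality of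
    [<x>]. *)
Definition small_powers n x : seq S :=
  undup [seq sexp x i | i <- iota 1 n.*2].

Lemma size_small_powers n x : size (small_powers n x) <= n.*2.
Proof. by rewrite (leq_trans (size_undup _)) // size_map size_iota. Qed.

(** Since [x ^ (2n) = x ^ n], any exponent above [2n] can be lowered by [n] without changing the
    power; strong induction brings it down to at most [2n]. *)
Lemma small_powersP n x y : exponent_bounds S n ->
  reflect (monogenic_sub x y) (y \in small_powers n x).
Proof.
move=> [n_gt0 idem_n]; rewrite mem_undup.
apply: (iffP mapP) => [[i]|[m]].
  by rewrite mem_iota => /andP[i_gt0 _] ->; exists i.
elim/ltn_ind: m => m IHm m_gt0 y_xm.
have [m_le|m_gt] := leqP m n.*2.
  by exists m; rewrite // mem_iota m_gt0 add1n ltnS.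
(* Write [m = 2n + r]; [r] must be positive for [sexpD] to split off [x ^ r]. *)
have r_gt0 : 0 < m - n.*2 by rewrite subn_gt0.
apply: (IHm (n + (m - n.*2))); last 1 first.
- rewrite y_xm -{1}(subnKC (ltnW m_gt)) -{1}addnn.
  rewrite sexpD ?addn_gt0 ?n_gt0 // [sexp x (n + n)]sexpD // idem_n.
  by rewrite -sexpD.
- by rewrite -{2}(subnKC (ltnW m_gt)) ltn_add2r -addnn -{1}[n]addn0 ltn_add2l.
- by rewrite addn_gt0 n_gt0.
Qed.

End SemigroupPowers.

Theorem theorem3p7 (S : semigroupType) (S_nonempty : [set: S] !=set0) (n : nat)
    (S_exponent : has_exponent S n) :
  complete_graph (enhanced_power_graph S) <-> monogenic S.
Proof.
(* Conversely, a generator of [S] serves as the common [z] for every pair. *)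
have [exp_n _] := S_exponent; split=> [S_complete|[a genS] x y xy]; last first.
  by split=> //; exists a; rewrite -genS.
(* The sizes of the subsemigroups [<x>], as a boolean predicate so that [ex_maxnP] can pick the
   largest. *)
pose P k := `[< exists x : S, size (small_powers n x) = k >].
have P_ex : exists k, P k.
  by have [x _] := S_nonempty; exists (size (small_powers n x)); apply/asboolP; exists x.
have P_le k : P k -> k <= n.*2.
  by move=> /asboolP[x <-]; exact: size_small_powers.
have [_ /asboolP[a <-] a_max] := ex_maxnP P_ex P_le.
exists a; apply/esym; rewrite -subTset => y _.
(* Completeness only concerns distinct vertices. *)
have [->|ay] := pselect (a = y); first exact: monogenic_sub_refl.
have [_ [z [za zy]]] := S_complete a y ay.
have sub_az : {subset small_powers n a <= small_powers n z}.
  move=> x /(small_powersP _ _ _ exp_n) ax; apply/(small_powersP _ _ _ exp_n).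
  exact: monogenic_sub_trans za ax.
have size_za : size (small_powers n z) <= size (small_powers n a).
  by apply: a_max; apply/asboolP; exists z.
(* A duplicate-free list contained in one that is no longer has the same elements. *)
have [_ eq_az] := uniq_min_size (undup_uniq _) sub_az size_za.
by apply/(small_powersP _ _ _ exp_n); rewrite eq_az; apply/small_powersP.
Qed.
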